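(* Let $\delta_1,\delta_2,\delta_3$ be distinct, all chosen to be integers or half-integers, with $\delta_1>\max(\delta_2,\delta_3)$. The scalar Lax pair $$Y_m\,\phi_{m+\delta_1+\delta_2}+\beta\zeta\,\phi_{m+\delta_2+\delta_3}=\xi\,\phi_m,\qquad \phi_{m+\delta_1-\delta_2}-X_m\,\phi_{m+\delta_1-\delta_3}=\zeta\,\phi_m,$$ where $$X_m=\frac{\tau_{m+2\delta_1-2\delta_3}\,\tau_{m+\delta_1-\delta_2}}{\tau_{m+2\delta_1-\delta_2-\delta_3}\,\tau_{m+\delta_1-\delta_3}},\qquad Y_m=\frac{\tau_{m+2\delta_1+\delta_2-\delta_3}\,\tau_{m}}{\tau_{m+\delta_1+\delta_2}\,\tau_{m+\delta_1-\delta_3}},$$ is equivalent to a matrix linear system of size $K=\max(\delta_1-\delta_2,\delta_1-\delta_3)$, of the form $$\mathbf{L}_m(\zeta)\,\mathbf{\Phi}_m=\xi\,\mathbf{\Phi}_m,\qquad \mathbf{\Phi}_{m+1}=\mathbf{M}_m(\zeta)\,\mathbf{\Phi}_m .$$ The compatibility condition of the latter system is the discrete Lax equation $$\mathbf{L}_{m+1}\mathbf{M}_m=\mathbf{M}_m\mathbf{L}_m,$$ which preserves the spectral curve in the $(\zeta,\xi)$ plane given by $$\mathcal{P}(\zeta,\xi)\equiv\det\big(\mathbf{L}_m(\zeta)-\xi\mathbf{1}\big)=0 .$$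
   Context: Here $\tau_m$ are the dynamical variables, $\phi_m$ is a scalar wave function, $\beta$ is a constant coefficient, and $\zeta,\xi$ are spectral parameters. The scalar pair is the plane wave reduction of the Lax pair of the Hirota–Miwa (discrete KP) equation, and its compatibility condition is the Somos-$N$ recurrence with $N=2\delta_1$, $\tau_{m+N}\tau_m=\alpha_m\tau_{m+\delta_1+\delta_2}\tau_{m+\delta_1-\delta_2}+\beta\tau_{m+\delta_1+\delta_3}\tau_{m+\delta_1-\delta_3}$, $\alpha_{m+\delta_1-\delta_3}=\alpha_m$. $\mathbf{\Phi}_m$ is the vector $(\phi_m,\phi_{m+1},\ldots,\phi_{m+K-1})^T$; $\mathbf{L}_m(\zeta)$ and $\mathbf{M}_m(\zeta)$ are $K\times K$ matrix functions of $\zeta$ and the dynamical variables; $\mathbf{1}$ is the $K\times K$ identity matrix. That the spectral curve is preserved means that the coefficients of the polynomial $\mathcal{P}(\zeta,\xi)$ are preserved under the evolution $m\to m+1$. *)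

(* Defs.v *)
From HB Require Import structures.
From mathcomp Require Import all_boot all_order all_algebra.

Set Implicit Arguments.
Unset Strict Implicit.
Unset Printing Implicit Defensive.

Import Order.TTheory GRing.Theory Num.Theory.
Local Open Scope ring_scope.

(* All three integers, or all three in 1/2 + Z: mixing the two would make the
   shifts d1 +- d2, d1 +- d3, d2 + d3 non-integral. *)
Definition int_or_half_int (d1 d2 d3 : rat) : Prop :=
  [/\ d1 \is a Num.int, d2 \is a Num.int & d3 \is a Num.int] \/
  [/\ d1 - 2^-1 \is a Num.int, d2 - 2^-1 \is a Num.int
    & d3 - 2^-1 \is a Num.int].

(* Only ever applied to combinations of d1, d2, d3 that are integers under
   int_or_half_int, so nothing is rounded. *)
Definition sh (x : rat) : int := Num.floor x.

Section LaxPair.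

Variables (F : fieldType) (d1 d2 d3 : rat) (tau : int -> F) (beta : F).

Definition somos : Prop :=
  exists alpha : int -> F,
    (forall m, alpha (m + sh (d1 - d3)) = alpha m) /\
    (forall m, tau (m + sh (2 * d1)) * tau m =
       alpha m * (tau (m + sh (d1 + d2)) * tau (m + sh (d1 - d2)))
       + beta * (tau (m + sh (d1 + d3)) * tau (m + sh (d1 - d3)))).

Definition laxX (m : int) : F :=
  (tau (m + sh (2 * d1 - 2 * d3)) * tau (m + sh (d1 - d2)))
  / (tau (m + sh (2 * d1 - d2 - d3)) * tau (m + sh (d1 - d3))).

Definition laxY (m : int) : F :=
  (tau (m + sh (2 * d1 + d2 - d3)) * tau m)
  / (tau (m + sh (d1 + d2)) * tau (m + sh (d1 - d3))).

Definition lax_size : nat := absz (sh (Num.max (d1 - d2) (d1 - d3))).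

Local Notation K := lax_size.

(* The wave function takes values in a commutative ring R with a ring morphism
   iota : F -> R; R = F and iota = id is the basic case.  The other rings are
   needed in [compatible] below. *)
Definition scalar_lax_pair (R : comNzRingType) (iota : {rmorphism F -> R})
    (zeta : F) (xi : R) (phi : int -> R) : Prop :=
  (forall m, iota (laxY m) * phi (m + sh (d1 + d2))
             + iota (beta * zeta) * phi (m + sh (d2 + d3)) = xi * phi m) /\
  (forall m, phi (m + sh (d1 - d2)) - iota (laxX m) * phi (m + sh (d1 - d3))
             = iota zeta * phi m).

Definition wave_vector (R : comNzRingType) (phi : int -> R) (m : int) :
  'cV[R]_K := \col_(i < K) phi (m + i%:Z).

(* The second scalar equation solved for phi_(m+K), as a row of coefficients on
   phi_m, ..., phi_(m+K-1).  If d1 - d2 is the larger shift, then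
   phi_(m+K) = zeta phi_m + X_m phi_(m+d1-d3); otherwise
   phi_(m+K) = X_m^-1 (phi_(m+d1-d2) - zeta phi_m). *)
Definition top_coef (m : int) (zeta : F) (j : nat) : F :=
  if d1 - d3 < d1 - d2 then
    zeta *+ (j == 0)%N + laxX m *+ (j%:Z == sh (d1 - d3))
  else
    (laxX m)^-1 * (1 *+ (j%:Z == sh (d1 - d2)) - zeta *+ (j == 0)%N).

Definition laxM (m : int) (zeta : F) : 'M[F]_K :=
  \matrix_(i < K, j < K)
    if (i.+1 < K)%N then ((j : nat) == i.+1)%:R else top_coef m zeta j.

Fixpoint transfer_nat (zeta : F) (m : int) (n : nat) : 'M[F]_K :=
  if n is n'.+1 then laxM (m + n'%:Z) zeta *m transfer_nat zeta m n'
  else 1%:M.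

(* Phi_(m+j) = transfer zeta m j Phi_m; for j < 0 this uses that laxM is
   invertible when zeta != 0. *)
Definition transfer (zeta : F) (m j : int) : 'M[F]_K :=
  match j with
  | Posz n => transfer_nat zeta m n
  | Negz n => invmx (transfer_nat zeta (m - n.+1%:Z) n.+1)
  end.

(* phi_(m+j) as a linear form in Phi_m. *)
Definition reduced (zeta : F) (m j : int) : 'rV[F]_K :=
  (\row_(i < K) ((i : nat) == 0)%:R) *m transfer zeta m j.

(* The second scalar equation at m + d2 + d3 reads
     zeta phi_(m+d2+d3) = phi_(m+d1+d3) - X_(m+d2+d3) phi_(m+d1+d2),
   so the first one is equivalent to
     (Y_m - beta X_(m+d2+d3)) phi_(m+d1+d2) + beta phi_(m+d1+d3) = xi phi_m.
   Row i of laxL is the left-hand side of this at m + i, reduced to Phi_m. *)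
Definition laxL (m : int) (zeta : F) : 'M[F]_K :=
  \matrix_(i < K, j < K)
    ((laxY (m + i%:Z) - beta * laxX (m + i%:Z + sh (d2 + d3)))
       * reduced zeta m (i%:Z + sh (d1 + d2)) ord0 j
     + beta * reduced zeta m (i%:Z + sh (d1 + d3)) ord0 j).

Definition matrix_lax_pair (R : comNzRingType) (iota : {rmorphism F -> R})
    (zeta : F) (xi : R) (Phi : int -> 'cV[R]_K) : Prop :=
  (forall m, map_mx iota (laxL m zeta) *m Phi m = xi *: Phi m) /\
  (forall m, Phi (m + 1) = map_mx iota (laxM m zeta) *m Phi m).

(* The values of zeta at which laxL is defined: it is polynomial in zeta when
   -d1 <= d2, d3 (always so when the recurrence has order 2 d1), and Laurent
   polynomial otherwise. *)
Definition regular_shifts : Prop := 0 <= d1 + d2 /\ 0 <= d1 + d3.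

Definition admissible (zeta : F) : Prop := zeta != 0 \/ regular_shifts.

(* Consistency of the two equations of the matrix system: whatever the value
   of xi, a solution of the eigenvalue equation at m is sent by laxM to a
   solution at m + 1.  The eigenvalue xi is a point of the spectral curve with
   values in any commutative ring over F, e.g. the generic point xi = 'X in
   F[X] / (det (L - X)), which may be non-reduced; for xi in F alone there may
   be too few eigenvectors to determine L_(m+1) M_m - M_m L_m. *)
Definition compatible (zeta : F) : Prop :=
  forall (R : comNzRingType) (iota : {rmorphism F -> R}) (xi : R) (m : int)
         (Phi : 'cV[R]_K),
    map_mx iota (laxL m zeta) *m Phi = xi *: Phi ->
    map_mx iota (laxL (m + 1) zeta) *m (map_mx iota (laxM m zeta) *m Phi)
      = xi *: (map_mx iota (laxM m zeta) *m Phi).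

Definition discrete_lax_equation (m : int) (zeta : F) : Prop :=
  laxL (m + 1) zeta *m laxM m zeta = laxM m zeta *m laxL m zeta.

(* P is a polynomial in xi with coefficients that are polynomials in zeta; the
   power of zeta clears the denominators of a Laurent polynomial laxL. *)
Definition spectral_polynomial (k : nat) (m : int) (P : {poly {poly F}}) :
    Prop :=
  forall zeta xi : F, admissible zeta ->
    P.[xi%:P].[zeta] = zeta ^+ k * \det (laxL m zeta - xi%:M).

End LaxPair.

(* Main.v *)
(* Write p = d1 - d2, q = d1 - d3, a = d1 + d2, T(m, n) for the matrix sending
   Phi_m to Phi_(m+n), and r(m, j) for the row expressing phi_(m+j) in Phi_m.
   Choose n with n + a >= 0 and n + d1 + d3 >= 0, and n = 0 for regular shifts.
   Then B_m = L_m T(m-n, n) only involves r(m-n, j) with j >= 0, so it is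
   polynomial in zeta, and the Lax equation is B_(m+1) M_(m-n) = M_m B_m.  All
   rows of the latter but the last agree by shifting; in the last row the
   identity Y_(m+p) X_(m+a) = X_m Y_(m+q) leaves, up to a unit,
     zeta (Y_(m+p) - beta X_m - Y_m + beta X_(m+d2+d3)) r(m-n, n+a) = 0,
   and the bracket is a nonzero multiple of alpha_(m+q) - alpha_m, where alpha is
   read off from the Somos recurrence.  Since det M_m is a nonzero constant times
   zeta, P = zeta^n det(L_m - xi) is det(B_m - xi T(m-n, n)) up to a constant.
   Its preservation is proved with zeta an indeterminate, so that finite fields
   need no separate treatment. *)
Require Import Defs.
From HB Require Import structures.
From mathcomp Require Import all_boot all_order all_algebra.
From mathcomp Require Import qpoly zify ring.

Set Implicit Arguments.
Unset Strict Implicit.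
Unset Printing Implicit Defensive.

Import Order.TTheory GRing.Theory Num.Theory.
Local Open Scope ring_scope.

(** Here [A], [B], [C], [R0], [R1] stand for a solution r of the recurrence at s+q, s+p = t+q, t+p,
    s, t. Eliminating [C] and then [A] leaves a multiple of [B - xs * A = z * R0], the only trace of
    the defect. *)
Lemma lax_identity (S : comNzRingType)
    (A B C R0 R1 wp wq w0 xs xt x z b : S) :
    B - xs * A = z * R0 -> C - xt * B = z * R1 ->
    (wp + b * xt - b * x) * xs = x * wq ->
  wp * B + b * C = z * (w0 * R0 + b * R1) + x * (wq * A + b * B)
                   + z * (wp + b * xt - b * x - w0) * R0.
Proof.
move=> E0 E1 E2.
have -> : z * (w0 * R0 + b * R1) + x * (wq * A + b * B)
    + z * (wp + b * xt - b * x - w0) * R0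
  = b * (z * R1) + x * wq * A + x * b * B + (wp + b * xt - b * x) * (z * R0).
  by ring.
by rewrite -E0 -E1 -E2; ring.
Qed.

(* The columns of the adjugate of X - A are eigenvectors of A over
   F[X] / (char_poly A).  So C = A' M - M A kills this adjugate modulo
   char_poly A, hence C = G (X - A) for a polynomial matrix G, and evaluating at
   X = A on the right gives C = 0. *)
Lemma eigenvector_intertwining (F : fieldType) n (A A' M : 'M[F]_n) :
    (forall (R : comNzRingType) (iota : {rmorphism F -> R}) (xi : R)
        (Phi : 'cV[R]_n),
      map_mx iota A *m Phi = xi *: Phi ->
      map_mx iota A' *m (map_mx iota M *m Phi) = xi *: (map_mx iota M *m Phi)) ->
  A' *m M = M *m A.
Proof.
(* [mk_monic] keeps [chi] only if its degree is positive, so size 0 is treated apart. *)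
case: n A A' M => [|n] A A' M compat; first by rewrite [LHS]flatmx0 [RHS]flatmx0.
set chi := char_poly A.
have chi_monic : chi \is monic by exact: char_poly_monic.
have chiE : mk_monic chi = chi by rewrite /mk_monic size_char_poly chi_monic.
pose f : {rmorphism {poly F} -> {poly %/ chi}} := in_qpoly chi.
pose iota : {rmorphism F -> {poly %/ chi}} := f \o polyC.
have f0 r : f r = 0 -> r = Pdiv.Ring.rdivp r chi * chi.
  move=> /(congr1 val) /=; rewrite chiE => r0.
  by rewrite {1}(Pdiv.RingMonic.rdivp_eq chi_monic r) r0 addr0.
have fchi : f chi = 0.
  by apply: val_inj; rewrite /= chiE Pdiv.RingMonic.rmodpp.
set D := \adj (char_poly_mx A).
have mapf k l (B : 'M[F]_(k, l)) : map_mx f (map_mx polyC B) = map_mx iota B.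
  by rewrite -map_mx_comp.
have AD : map_mx iota A *m map_mx f D = f 'X *: map_mx f D.
  have := congr1 (map_mx f) (mul_mx_adj (char_poly_mx A)).
  rewrite -/(char_poly A) -/chi map_scalar_mx /= fchi -/D map_mxM map_mxB mapf.
  rewrite map_scalar_mx mulmxBl mul_scalar_mx => /eqP.
  by rewrite raddf0 subr_eq0 => /eqP ->.
have CD : map_mx f (map_mx polyC (A' *m M - M *m A) *m D) = 0.
  rewrite map_mxM mapf map_mxB !map_mxM mulmxBl -!mulmxA AD -scalemxAr.
  apply/eqP; rewrite subr_eq0; apply/eqP/matrixP => i j.
  have := compat _ iota (f 'X) (col j (map_mx f D)).
  rewrite colE !mulmxA AD -scalemxAl => /(_ erefl); rewrite scalemxAl -!colE.
  by move=> /colP/(_ i); rewrite !(mxE, mulmxA).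
pose G := map_mx (fun r => Pdiv.Ring.rdivp r chi)
  (map_mx polyC (A' *m M - M *m A) *m D).
have CG : map_mx polyC (A' *m M - M *m A) *m D = chi *: G.
  apply/matrixP => i j; rewrite [RHS]mxE [X in _ * X]mxE mulrC; apply: f0.
  by have /matrixP/(_ i j) := CD; rewrite !mxE.
have CE : map_mx polyC (A' *m M - M *m A) = G *m char_poly_mx A.
  have chi0 : chi != 0 := monic_neq0 chi_monic.
  have E : chi *: map_mx polyC (A' *m M - M *m A) = chi *: (G *m char_poly_mx A).
    by rewrite scalemxAl -CG -mulmxA mul_adj_mx mul_mx_scalar.
  apply/matrixP => i j; apply: (mulfI chi0).
  by have /matrixP/(_ i j) := E; rewrite 2!mxE [RHS]mxE.
(* Matrices of polynomials become polynomials with matrix coefficients, where the difference is a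
   constant having [A] as a root. *)
have [phi [_ phiZ phiC _]] := mx_poly_ring_isom F n.
apply/eqP; rewrite -subr_eq0 -(rootC _ A) -phiC CE.
apply/factor_theorem; exists (phi G).
by rewrite -[G *m _]/(G * _) rmorphM rmorphB /= phiC phiZ map_polyX.
Qed.

(** * Transfer matrices of a three-term recurrence over a commutative ring *)

Section Recurrence.

Variables (S : comNzRingType) (p q K : nat) (x y : int -> S) (z : S).

(* Value at [K] of a solution [g] of [g p - x m * g q = z * g 0], when [y] is
   the inverse of [x]. *)
Definition rec_next (m : int) (g : nat -> S) : S :=
  if (q < p)%N then z * g 0 + x m * g q else y m * (g p - z * g 0).

Definition rec_top (m : int) (j : nat) : S :=
  if (q < p)%N then z *+ (j == 0)%N + x m *+ (j == q)
  else y m * (1 *+ (j == p) - z *+ (j == 0)%N).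

Definition rec_step (m : int) : 'M[S]_K :=
  \matrix_(i < K, j < K)
    if (i.+1 < K)%N then ((j : nat) == i.+1)%:R else rec_top m j.

Fixpoint rec_transfer (m : int) (n : nat) : 'M[S]_K :=
  if n is n'.+1 then rec_step (m + n'%:Z) *m rec_transfer m n' else 1%:M.

Definition rec_row (m : int) (n : nat) : 'rV[S]_K :=
  (\row_(i < K) ((i : nat) == 0)%:R) *m rec_transfer m n.

(** The coefficient of [z * g 0] in [rec_next]; up to sign, the unit in det M_m. *)
Definition rec_lead (m : int) : S := if (q < p)%N then 1 else - y m.

Hypotheses (Kmax : K = maxn p q) (p_gt0 : (0 < p)%N) (q_gt0 : (0 < q)%N).
Hypotheses (pq : p != q) (yx : forall m, y m * x m = 1).

Lemma sum_ord_pick (c : S) (g : nat -> S) (k : nat) : (k < K)%N ->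
  \sum_(j < K) (c *+ (j == k :> nat)) * g j = c * g k.
Proof.
move=> kK; rewrite (bigD1 (Ordinal kK)) //= eqxx mulr1n big1 ?addr0 // => j.
by rewrite -val_eqE /= => /negbTE ->; rewrite mulr0n mul0r.
Qed.

Lemma sum_rec_top m (g : nat -> S) :
  \sum_(j < K) rec_top m j * g j = rec_next m g.
Proof.
have K0 : (0 < K)%N by lia.
rewrite /rec_top /rec_next; case: ifP => qp.
  rewrite -(sum_ord_pick z g K0) -(sum_ord_pick (x m) g (k := q)); last by lia.
  by rewrite -big_split; apply: eq_bigr => j _; rewrite mulrDl.
have pK : (p < K)%N by lia.
rewrite -(sum_ord_pick z g K0) -[g p]mul1r -(sum_ord_pick 1 g pK).
rewrite -sumrB mulr_sumr.
by apply: eq_bigr => j _; rewrite -mulrA mulrBl.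
Qed.

Lemma mul_rec_step m n (A : 'M[S]_(K, n)) (g : nat -> S) i k :
    (forall j : 'I_K, A j k = g j) ->
  (rec_step m *m A) i k = if (i.+1 < K)%N then g i.+1 else rec_next m g.
Proof.
move=> Ag; rewrite mxE -sum_rec_top; under eq_bigr do rewrite Ag mxE.
by case: ifP => // iK; rewrite sum_ord_pick ?mul1r.
Qed.

Lemma rec_nextP m (g : nat -> S) :
  g K = rec_next m g <-> g p - x m * g q = z * g 0.
Proof.
rewrite /rec_next; case: ifP => qp.
  have -> : K = p by lia.
  by split=> [->|<-]; ring.
have -> : K = q by lia.
split=> [->|<-].
  by rewrite mulrA [x m * _]mulrC yx; ring.
by rewrite opprB addrCA subrr addr0 mulrA yx mul1r.
Qed.

Lemma rec_rowE m n (i0 : 'I_K) : i0 = 0%N :> nat ->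
  rec_row m n = row i0 (rec_transfer m n).
Proof.
move=> i00; rewrite rowE; congr (_ *m _); apply/rowP => i.
by rewrite !mxE eqxx /= -val_eqE /= i00.
Qed.

(** [rec_step] shifts every row but the last up by one, so row i+1 after n steps is row i after n+1
    steps. *)
Lemma rec_transferE m n i k :
  rec_transfer m n i k = rec_row m (i + n) ord0 k.
Proof.
case: i => i; elim: i n => [|i IHi] n iK.
  by rewrite (rec_rowE _ _ (i0 := Ordinal iK)) // mxE.
have iK' : (i < K)%N by lia.
rewrite addSnnS -(IHi _ iK') /=.
(* [insubd] extends the column to all of [nat]; the default is never read, as only the index i+1 < K
   is used. *)
pose g j := rec_transfer m n (insubd (Ordinal iK) j) k.
rewrite (mul_rec_step _ _ (g := g)); last by move=> j; rewrite /g valKd.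
rewrite /= iK /g; congr (rec_transfer m n _ k); apply: val_inj.
by rewrite val_insubd iK.
Qed.

(** The last row of T(m, n+1) is r(m, n+K), and [rec_step] produces it through [rec_next]. *)
Lemma rec_row_rec m n k :
  rec_row m (n + p) ord0 k - x (m + n%:Z) * rec_row m (n + q) ord0 k
    = z * rec_row m n ord0 k.
Proof.
have := @rec_nextP (m + n%:Z) (fun j => rec_row m (j + n) ord0 k).
rewrite ![(n + _)%N]addnC => -[+ _]; apply.
have K1 : (K.-1 < K)%N by lia.
have -> : (K + n = K.-1 + n.+1)%N by lia.
have /= <- := @rec_transferE m n.+1 (Ordinal K1) k.
rewrite (mul_rec_step _ _ (g := fun j => rec_row m (j + n) ord0 k)).
  by rewrite /= ifF //; lia.
by move=> j; rewrite rec_transferE.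
Qed.

Lemma rec_transferD m n n' :
  rec_transfer m (n + n') = rec_transfer (m + n'%:Z) n *m rec_transfer m n'.
Proof.
elim: n => [|n IHn]; first by rewrite mul1mx.
rewrite addSn /= IHn mulmxA; congr (rec_step _ *m _ *m _).
by rewrite PoszD [n%:Z + _]addrC addrA.
Qed.

Lemma rec_transfer1 m : rec_transfer m 1 = rec_step m.
Proof. by rewrite /= addr0 mulmx1. Qed.

(** Both sides are T(m, n+1), with its first or its last step split off. *)
Lemma rec_transfer_comm m n :
  rec_transfer (m + 1) n *m rec_step m
    = rec_step (m + n%:Z) *m rec_transfer m n.
Proof.
by rewrite -[RHS]/(rec_transfer m n.+1) -addn1 rec_transferD rec_transfer1.
Qed.

Lemma rec_rowD m n n' :
  rec_row m (n + n') = rec_row (m + n'%:Z) n *m rec_transfer m n'.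
Proof. by rewrite /rec_row rec_transferD mulmxA. Qed.

(** Column 0 is nonzero only in the last row, and the complementary minor is the identity. *)
Lemma det_rec_step m : \det (rec_step m) = (-1) ^+ K.-1 * rec_lead m * z.
Proof.
move: Kmax; rewrite /rec_step; case: K => [|k] kmax; first by lia.
rewrite (expand_det_col _ ord0) (bigD1 ord_max) //= big1 ?addr0 /cofactor.
  have -> : row' ord_max (col' ord0 (\matrix_(i < k.+1, j < k.+1)
      if (i.+1 < k.+1)%N then ((j : nat) == i.+1)%:R else rec_top m j))
      = 1%:M :> 'M[S]_k.
    apply/matrixP => i j; rewrite !mxE /= /bump /=.
    by rewrite (leqNgt k) ltn_ord /= add0n ltnS ltn_ord add1n eqSS eq_sym.
  rewrite det1 mulr1 !mxE /= ltnn addn0 -mulrA mulrC; congr (_ * _).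
  rewrite /rec_top /rec_lead; case: ifP => qp.
    have -> : (0 == q)%N = false by lia.
    by rewrite /= addr0 mulr1n mul1r.
  have -> : (0 == p)%N = false by lia.
  by rewrite mulr0n mulr1n sub0r mulrN mulNr.
move=> i ik; rewrite !mxE ifT ?mul0r //.
have := ltn_ord i; move: ik; rewrite -val_eqE /=; lia.
Qed.

Lemma det_rec_transfer m n : \det (rec_transfer m n) =
  (\prod_(i < n) ((-1) ^+ K.-1 * rec_lead (m + i%:Z))) * z ^+ n.
Proof.
elim: n => [|n IHn]; first by rewrite det1 big_ord0 mulr1.
by rewrite /= det_mulmx IHn det_rec_step big_ord_recr exprS /=; ring.
Qed.

(** All rows of the step equation but the last are mere reindexing; the last one is the
    recurrence. *)
Lemma wave_recP (phi : int -> S) :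
  (forall m, (\col_(i < K) phi (m + 1 + i%:Z) : 'cV_K)
             = rec_step m *m \col_(i < K) phi (m + i%:Z)) <->
  (forall m, phi (m + p%:Z) - x m * phi (m + q%:Z) = z * phi m).
Proof.
have step m i : (rec_step m *m \col_(i < K) phi (m + i%:Z)) i ord0 =
  if (i.+1 < K)%N then phi (m + i.+1%:Z)
  else rec_next m (fun j => phi (m + j%:Z)).
  by apply: mul_rec_step => j; rewrite mxE.
split=> [Hphi m | Hphi m].
  have /rec_nextP : phi (m + K%:Z) = rec_next m (fun j => phi (m + j%:Z)).
    have K1 : (K.-1 < K)%N by lia.
    have /matrixP/(_ (Ordinal K1) ord0) := Hphi m.
    rewrite step mxE /= ifF; last by lia.
    by move=> <-; congr phi; lia.
  by rewrite addr0.
apply/colP => i; rewrite step mxE.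
case: ifP => iK; first by congr phi; lia.
rewrite -(iffRL (rec_nextP m (fun j => phi (m + j%:Z)))) ?addr0 //.
by congr phi; have := ltn_ord i; lia.
Qed.

Lemma transfer_wave (phi : int -> S) :
    (forall m, phi (m + p%:Z) - x m * phi (m + q%:Z) = z * phi m) ->
  forall m n, rec_transfer m n *m (\col_(i < K) phi (m + i%:Z))
    = (\col_(i < K) phi (m + n%:Z + i%:Z) : 'cV_K).
Proof.
move=> /wave_recP Hphi m; elim=> [|n IHn].
  by rewrite mul1mx addr0.
rewrite /= -mulmxA IHn -Hphi; apply/colP => i; rewrite !mxE.
by congr phi; lia.
Qed.

Lemma row_wave (phi : int -> S) :
    (forall m, phi (m + p%:Z) - x m * phi (m + q%:Z) = z * phi m) ->
  forall m n, (rec_row m n *m (\col_(i < K) phi (m + i%:Z))) ord0 ord0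
    = phi (m + n%:Z).
Proof.
move=> Hphi m n; have K0 : (0 < K)%N by lia.
rewrite (rec_rowE _ _ (i0 := Ordinal K0)) // -row_mul transfer_wave // !mxE.
by rewrite addr0.
Qed.

Variables (w : int -> S) (b : S) (n s t : nat).
Hypothesis (spt : (s + p = t + q)%N).

(** The matrix B_m of the overview, later with s = d1 + d2 + n and t = d1 + d3 + n: starting at m -
    n keeps the row indices natural numbers. *)
Definition rec_band (m : int) : 'M[S]_K :=
  \matrix_(i < K, k < K)
    (w (m + i%:Z) * rec_row (m - n%:Z) (i + s) ord0 k
     + b * rec_row (m - n%:Z) (i + t) ord0 k).

Definition rec_defect (m : int) : S :=
  w (m + p%:Z) + b * x (m - n%:Z + t%:Z) - b * x m - w m.

Hypothesis w_compat : forall m,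
  (w (m + p%:Z) + b * x (m - n%:Z + t%:Z) - b * x m) * x (m - n%:Z + s%:Z)
    = x m * w (m + q%:Z).

Lemma rec_band_lax m :
  rec_band (m + 1) *m rec_step (m - n%:Z) - rec_step m *m rec_band m =
  \matrix_(i < K, k < K)
     if (i.+1 < K)%N then 0
     else rec_lead m * z * rec_defect m * rec_row (m - n%:Z) s ord0 k.
Proof.
apply/matrixP => i k; set mu := m - n%:Z.
pose g j := w (m + j%:Z) * rec_row mu (j + s) ord0 k
            + b * rec_row mu (j + t) ord0 k.
have -> : (rec_band (m + 1) *m rec_step mu - rec_step m *m rec_band m) i k
    = (rec_band (m + 1) *m rec_step mu) i k - (rec_step m *m rec_band m) i k.
  by rewrite !mxE.
rewrite (mul_rec_step _ _ (g := g)); last by move=> j; rewrite mxE.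
(* Right multiplication by [rec_step mu] turns r(mu+1, j) into r(mu, j+1), which raises the band
   index by one. *)
have -> : (rec_band (m + 1) *m rec_step mu) i k = g i.+1.
  have shift j : (rec_row (mu + 1) j *m rec_step mu) ord0 k
      = rec_row mu j.+1 ord0 k.
    by rewrite -[j.+1]addn1 rec_rowD rec_transfer1.
  rewrite /g !addSn -!shift !mxE !mulr_sumr -big_split; apply: eq_bigr => j _.
  rewrite mxE /mu [m + 1 - _]addrAC.
  have -> : m + 1 + i%:Z = m + i.+1%:Z by lia.
  by rewrite mulrDl !mulrA.
rewrite [RHS]mxE; case: ifP => iK; first by rewrite subrr.
have -> : i.+1 = K by have := ltn_ord i; lia.
have Hs := rec_row_rec mu s k; have Ht := rec_row_rec mu t k.
rewrite spt in Hs; move: Hs Ht (w_compat m) (yx m).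
rewrite /rec_next /rec_lead /rec_defect -/mu.
(* If q < p, then K = p and [lax_identity] gives [g p] directly. Otherwise K = q, and solving for
   [g q] brings in the factor [- y m] of [rec_lead]. *)
case: ifP => qp Hs Ht Hw Hy.
  have -> : g K = g p by congr g; lia.
  rewrite /g !(addnC p) !(addnC q) !add0n addr0 spt.
  by rewrite (lax_identity (w m) Hs Ht Hw) mul1r addrC addKr.
have -> : g K = g q by congr g; lia.
rewrite /g !(addnC p) !(addnC q) !add0n addr0 spt.
have addKsub (u v v' : S) : u + v + v' - u = v + v' by ring.
rewrite (lax_identity (w m) Hs Ht Hw) addKsub.
by rewrite mulrDr mulrA Hy mul1r opprD addNKr !mulNr !mulrA.
Qed.

End Recurrence.

(** * Base change of the transfer and band matrices along ring morphisms *)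

Section Morphism.

Variables (S S' : comNzRingType) (f : {rmorphism S -> S'}).
Variables (p q K : nat) (x y : int -> S) (z : S).
Variables (x' y' : int -> S') (z' : S').
Hypotheses (fx : f \o x =1 x') (fy : f \o y =1 y') (fz : f z = z').

Lemma map_rec_step m :
  map_mx f (rec_step p q K x y z m) = rec_step p q K x' y' z' m.
Proof.
apply/matrixP => i j; rewrite !mxE -fz; case: ifP => _; first exact: rmorph_nat.
rewrite /rec_top -fx -fy; case: ifP => _ /=.
  by rewrite rmorphD !rmorphMn.
by rewrite rmorphM rmorphB !rmorphMn rmorph1.
Qed.

Lemma map_rec_transfer m n :
  map_mx f (rec_transfer p q K x y z m n) = rec_transfer p q K x' y' z' m n.
Proof.
elim: n => [|n IHn]; first exact: map_mx1.
by rewrite /= map_mxM IHn map_rec_step.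
Qed.

Lemma map_rec_row m n :
  map_mx f (rec_row p q K x y z m n) = rec_row p q K x' y' z' m n.
Proof.
rewrite /rec_row map_mxM map_rec_transfer; congr (_ *m _).
by apply/rowP => i; rewrite !mxE rmorph_nat.
Qed.

Lemma map_rec_band w w' b b' n s t m : f \o w =1 w' -> f b = b' ->
  map_mx f (rec_band p q K x y z w b n s t m) =
  rec_band p q K x' y' z' w' b' n s t m.
Proof.
move=> fw <-; apply/matrixP => i k.
rewrite mxE [X in f X = _]mxE [RHS]mxE -!map_rec_row -fw.
by rewrite rmorphD !rmorphM ![map_mx f _ _ _]mxE.
Qed.

End Morphism.

(** * The Lax pair in integer shifts and the Somos recurrence *)

Section LaxPair.

Variables (F : fieldType) (d1 d2 d3 : rat) (tau : int -> F) (beta : F).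
Variables (a : int) (p q : nat).
Hypotheses (d12 : d1 + d2 = a%:~R) (d12' : d1 - d2 = p%:~R)
  (d13' : d1 - d3 = q%:~R).
Hypotheses (p_gt0 : (0 < p)%N) (q_gt0 : (0 < q)%N) (pq : p != q).
Hypothesis tau_neq0 : forall m, tau m != 0.

Local Notation K := (lax_size d1 d2 d3).
Local Notation X := (laxX d1 d2 d3 tau).
Local Notation Xi := (fun m => (laxX d1 d2 d3 tau m)^-1).
Local Notation Y := (laxY d1 d2 d3 tau).
Local Notation b := (a + p%:Z - q%:Z).

Lemma shE (e : rat) (k : int) : e = k%:~R -> sh e = k.
Proof. by move->; exact: intrKfloor. Qed.

Lemma sh12 : sh (d1 + d2) = a. Proof. exact: shE. Qed.
Lemma sh12' : sh (d1 - d2) = p. Proof. exact: shE. Qed.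
Lemma sh13' : sh (d1 - d3) = q. Proof. exact: shE. Qed.

Lemma d13 : d1 + d3 = b%:~R.
Proof. by rewrite rmorphB rmorphD /= -d12 -d12' -d13'; ring. Qed.

Lemma sh13 : sh (d1 + d3) = b. Proof. exact/shE/d13. Qed.

Lemma sh23 : sh (d2 + d3) = a - q%:Z.
Proof. by apply: shE; rewrite rmorphB /= -d12 -d13'; ring. Qed.

Lemma sh_order : sh (2 * d1) = a + p%:Z.
Proof. by apply: shE; rewrite rmorphD /= -d12 -d12'; ring. Qed.

Lemma laxXE m : X m = (tau (m + (q + q)%N%:Z) * tau (m + p%:Z))
  / (tau (m + (p + q)%N%:Z) * tau (m + q%:Z)).
Proof.
rewrite /laxX sh12' sh13' (@shE _ (q + q)%N) ?(@shE (_ - _ - _) (p + q)%N) //.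
  by rewrite PoszD rmorphD /= -d12' -d13'; ring.
by rewrite PoszD rmorphD /= -d13'; ring.
Qed.

Lemma laxYE m : Y m = (tau (m + (a + q%:Z)) * tau m)
  / (tau (m + a) * tau (m + q%:Z)).
Proof.
rewrite /laxY sh12 sh13' (@shE _ (a + q%:Z)) //.
by rewrite rmorphD /= -d12 -d13'; ring.
Qed.

Lemma lax_sizeE : K = maxn p q.
Proof.
rewrite /lax_size d12' d13'.
have -> : Num.max (p%:~R : rat) q%:~R = (maxn p q)%:~R.
  by rewrite /Order.max ltr_int ltz_nat; case: ltnP => h; congr (_%:~R); lia.
by rewrite (shE erefl).
Qed.

Lemma laxX_neq0 m : X m != 0.
Proof. by rewrite laxXE mulf_neq0 ?invr_neq0 // mulf_neq0. Qed.

Lemma laxXV m : Xi m * X m = 1.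
Proof. by rewrite mulVf ?laxX_neq0. Qed.

Lemma laxM_rec zeta m :
  laxM d1 d2 d3 tau m zeta = rec_step p q K X Xi zeta m.
Proof.
apply/matrixP => i j; rewrite !mxE; case: ifP => // _.
rewrite /top_coef /rec_top sh12' sh13' d12' d13' ltr_int ltz_nat.
by case: ifP.
Qed.

(** Take for phi_m the first entry of Phi_m: the shift rows of [laxM] make entry i+1 of Phi_m equal
    to entry i of Phi_(m+1). *)
Lemma matrix_lax_wave (R : comNzRingType) (iota : {rmorphism F -> R})
    (zeta : F) (xi : R) (Phi : int -> 'cV[R]_K) :
    matrix_lax_pair tau beta iota zeta xi Phi ->
  exists phi : int -> R, forall m, Phi m = wave_vector d1 d2 d3 phi m.
Proof.
move=> [_ PhiM]; have K0 : (0 < K)%N by rewrite lax_sizeE; lia.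
exists (fun m => Phi m (Ordinal K0) ord0) => m; apply/colP => i; rewrite mxE.
case: i => i; elim: i m => [|i IHi] m iK.
  by rewrite addr0; congr (Phi m _ _); exact: val_inj.
have iK' : (i < K)%N by lia.
have -> : m + i.+1%:Z = m + 1 + i%:Z by lia.
rewrite -(IHi (m + 1) iK') PhiM laxM_rec.
pose g j := Phi m (insubd (Ordinal iK) j) ord0.
rewrite (@map_rec_step _ _ iota p q K X Xi zeta (iota \o X) (iota \o Xi)
  (iota zeta)) //.
rewrite (@mul_rec_step R p q K (iota \o X) (iota \o Xi) (iota zeta)
  lax_sizeE p_gt0 q_gt0 pq m 1 (Phi m) g) => [|j].
  by rewrite /= iK /g; congr (Phi m _ _); apply: val_inj; rewrite val_insubd iK.
by rewrite /g valKd.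
Qed.

Lemma transfer_nat_rec zeta m n :
  transfer_nat d1 d2 d3 tau zeta m n = rec_transfer p q K X Xi zeta m n.
Proof. by elim: n => //= n ->; rewrite laxM_rec. Qed.

(** The coefficient of phi_(m+d1+d2) once phi_(m+d2+d3) is eliminated; [a - q] is d2 + d3. *)
Definition laxW (m : int) : F := Y m - beta * X (m + (a - q%:Z)).

Lemma laxW_shift m : laxW (m + p%:Z) + beta * X (m + b) = Y (m + p%:Z).
Proof.
have -> : m + b = m + p%:Z + (a - q%:Z) by ring.
by rewrite /laxW subrK.
Qed.

Lemma laxW_compat m :
  (laxW (m + p%:Z) + beta * X (m + b) - beta * X m) * X (m + a)
    = X m * laxW (m + q%:Z).
Proof.
rewrite laxW_shift /laxW mulrBl mulrBr.
have -> : m + q%:Z + (a - q%:Z) = m + a by ring.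
(* The terms in [beta] agree; what remains is Y_(m+p) X_(m+a) = X_m Y_(m+q). The arguments of [tau]
   are then normalised so that [field] sees equal atoms. *)
congr (_ - _); last by ring.
rewrite !laxXE !laxYE.
have -> : m + a + (q + q)%N%:Z = m + q%:Z + (a + q%:Z) by lia.
have -> : m + (q + q)%N%:Z = m + q%:Z + q%:Z by lia.
have -> : m + a + (p + q)%N%:Z = m + p%:Z + (a + q%:Z) by lia.
have -> : m + a + p%:Z = m + p%:Z + a by lia.
have -> : m + a + q%:Z = m + q%:Z + a by lia.
have -> : m + (p + q)%N%:Z = m + p%:Z + q%:Z by lia.
by field; rewrite !tau_neq0.
Qed.

(** The recurrence forces alpha to be [al]. Both sides of the right-hand equation are [al (m + q)]
    and [al m] times the same nonzero factor, so it expresses the period d1 - d3 of alpha. *)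
Lemma somosP : somos d1 d2 d3 tau beta <->
  forall m, Y (m + p%:Z) - beta * X m = laxW m.
Proof.
pose al m := (tau (m + (a + p%:Z)) * tau m
    - beta * (tau (m + b) * tau (m + q%:Z))) / (tau (m + a) * tau (m + p%:Z)).
have WE m : laxW m = al m * (tau (m + (a + q%:Z)) * tau (m + p%:Z)
    / (tau (m + q%:Z) * tau (m + (a + p%:Z)))).
  rewrite /laxW /al laxXE laxYE.
  have -> : m + (a - q%:Z) + (q + q)%N%:Z = m + (a + q%:Z) by lia.
  have -> : m + (a - q%:Z) + p%:Z = m + b by lia.
  have -> : m + (a - q%:Z) + (p + q)%N%:Z = m + (a + p%:Z) by lia.
  have -> : m + (a - q%:Z) + q%:Z = m + a by lia.
  by field; rewrite !tau_neq0.
have YE m : Y (m + p%:Z) - beta * X m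
    = al (m + q%:Z) * (tau (m + (a + q%:Z)) * tau (m + p%:Z)
    / (tau (m + q%:Z) * tau (m + (a + p%:Z)))).
  rewrite /al laxXE laxYE.
  have -> : m + p%:Z + (a + q%:Z) = m + q%:Z + (a + p%:Z) by lia.
  have -> : m + (q + q)%N%:Z = m + q%:Z + q%:Z by lia.
  have -> : m + (p + q)%N%:Z = m + q%:Z + p%:Z by lia.
  have -> : m + p%:Z + q%:Z = m + q%:Z + p%:Z by lia.
  have -> : m + p%:Z + a = m + (a + p%:Z) by lia.
  have -> : m + q%:Z + b = m + (a + p%:Z) by lia.
  have -> : m + q%:Z + a = m + (a + q%:Z) by lia.
  by field; rewrite !tau_neq0.
rewrite /somos sh_order sh12 sh12' sh13 sh13'.
split=> [[alpha [per rec]] m | E].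
  rewrite YE WE; suff ale k : al k = alpha k by rewrite !ale per.
  by rewrite /al rec addrK mulfK // mulf_neq0.
exists al; split=> m; last by rewrite /al divfK ?mulf_neq0 // subrK.
have := E m; rewrite YE WE; apply: mulIf.
by rewrite mulf_neq0 ?invr_neq0 // mulf_neq0.
Qed.

(** * The matrix L_m through its band form, and the Lax equation *)

Variables (n s t : nat).
Hypotheses (sE : s%:Z = a + n%:Z) (tE : t%:Z = b + n%:Z).

Local Notation T := (rec_transfer p q K X Xi).
Local Notation Band zeta := (rec_band p q K X Xi zeta laxW beta n s t).

Lemma rec_lead_neq0 m : rec_lead p q Xi m != 0.
Proof.
by rewrite /rec_lead; case: ifP; rewrite ?oner_eq0 // oppr_eq0 invr_neq0 ?laxX_neq0.
Qed.

(** The determinant is a nonzero constant times [zeta ^+ k]; the case k = 0 serves zeta = 0 with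
    regular shifts. *)
Lemma rec_transfer_unit zeta m k :
  zeta != 0 \/ k = 0%N -> T zeta m k \in unitmx.
Proof.
move=> adm; rewrite unitmxE (det_rec_transfer _ _ _ lax_sizeE) // unitfE.
rewrite mulf_neq0 //; last first.
  by case: adm => [|->]; [exact: expf_neq0 | exact: oner_neq0].
by apply/prodf_neq0 => i _; rewrite mulf_neq0 ?signr_eq0 ?rec_lead_neq0.
Qed.

(** For j < 0, T(m-n, n) ends with T(m+j, -j), which cancels the inverse in [transfer]. *)
Lemma reduced_rec zeta m j k :
    zeta != 0 \/ n = 0%N -> k%:Z = j + n%:Z ->
  reduced d1 d2 d3 tau zeta m j *m T zeta (m - n%:Z) n
    = rec_row p q K X Xi zeta (m - n%:Z) k.
Proof.
move=> adm kE; rewrite /reduced /rec_row -mulmxA; congr (_ *m _).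
case: j kE => j kE; rewrite /transfer transfer_nat_rec.
  have -> : k = (j + n)%N by lia.
  by rewrite rec_transferD subrK.
rewrite NegzE in kE; have -> : n = (j.+1 + k)%N by lia.
rewrite rec_transferD.
have -> : m - (j.+1 + k)%N%:Z + k%:Z = m - j.+1%:Z by lia.
rewrite mulKmx // rec_transfer_unit //.
by case: adm => [|n0]; [left | lia].
Qed.

Lemma laxL_band zeta m : zeta != 0 \/ n = 0%N ->
  laxL d1 d2 d3 tau beta m zeta *m T zeta (m - n%:Z) n = Band zeta m.
Proof.
move=> adm; apply/matrixP => i k; rewrite [RHS]mxE.
rewrite -(@reduced_rec zeta m (i%:Z + a) (i + s)) //; last by lia.
rewrite -(@reduced_rec zeta m (i%:Z + b) (i + t)) //; last by lia.
rewrite !mxE !mulr_sumr -big_split; apply: eq_bigr => j _.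
rewrite mxE sh12 sh13 sh23 /laxW addrA /=.
by rewrite mulrDl !mulrA.
Qed.

(** The Lax equation is multiplied on the right by the invertible T(m-n, n), which passes M_m by
    [rec_transfer_comm]. *)
Lemma lax_bandP zeta m : zeta != 0 \/ n = 0%N ->
  discrete_lax_equation d1 d2 d3 tau beta m zeta <->
  Band zeta (m + 1) *m rec_step p q K X Xi zeta (m - n%:Z)
    = rec_step p q K X Xi zeta m *m Band zeta m.
Proof.
move=> adm; rewrite -!laxL_band // /discrete_lax_equation !laxM_rec.
have := rec_transfer_comm p q K X Xi zeta (m - n%:Z) n.
rewrite addrAC subrK -mulmxA => ->; rewrite !mulmxA; split=> [-> // | E].
exact: (can_inj (mulmxK (rec_transfer_unit (m - n%:Z) adm))).
Qed.

Lemma rec_defectE m :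
  rec_defect p X laxW beta n t m = Y (m + p%:Z) - beta * X m - laxW m.
Proof.
rewrite /rec_defect -laxW_shift.
by have -> : m - n%:Z + t%:Z = m + b by lia.
Qed.

Lemma lax_band_sub zeta m :
  Band zeta (m + 1) *m rec_step p q K X Xi zeta (m - n%:Z)
    - rec_step p q K X Xi zeta m *m Band zeta m =
  \matrix_(i < K, k < K)
     if (i.+1 < K)%N then 0
     else rec_lead p q Xi m * zeta * (Y (m + p%:Z) - beta * X m - laxW m)
            * rec_row p q K X Xi zeta (m - n%:Z) s ord0 k.
Proof.
have spt : (s + p = t + q)%N by lia.
rewrite (rec_band_lax _ lax_sizeE p_gt0 q_gt0 pq laxXV spt) ?rec_defectE // => k.
have -> : k - n%:Z + t%:Z = k + b by lia.
have -> : k - n%:Z + s%:Z = k + a by lia.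
exact: laxW_compat.
Qed.

Lemma lax_equationP :
  (forall zeta m, zeta != 0 \/ n = 0%N ->
     discrete_lax_equation d1 d2 d3 tau beta m zeta) <->
  (forall m, Y (m + p%:Z) - beta * X m = laxW m).
Proof.
split=> [lax m | E zeta m adm]; last first.
  apply/lax_bandP/subr0_eq => //; rewrite lax_band_sub; apply/matrixP => i k.
  by rewrite !mxE E subrr mulr0 mul0r if_same.
(* For this direction zeta = 1 suffices: it is nonzero in every field, so all transfers are
   invertible there. *)
have n1 : (1 : F) != 0 \/ n = 0%N by left; exact: oner_neq0.
have /eqP := (lax_bandP m n1).1 (lax 1 m n1).
rewrite -subr_eq0 lax_band_sub => /eqP/matrixP Z0.
have K1 : (K.-1 < K)%N by rewrite lax_sizeE; lia.
apply/eqP; rewrite -subr_eq0; apply/negP => /negP D0.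
have row0 : rec_row p q K X Xi 1 (m - n%:Z) s = 0.
  apply/rowP => k; rewrite [RHS]mxE; have := Z0 (Ordinal K1) k.
  rewrite [X in X = _]mxE [X in _ = X]mxE ifF /=; last by rewrite lax_sizeE; lia.
  move/eqP; rewrite mulr1 !mulf_eq0 (negPf D0) (negPf (rec_lead_neq0 m)) /=.
  by move/eqP.
have Tu : T 1 (m - n%:Z) s \in unitmx.
  by apply: rec_transfer_unit; left; exact: oner_neq0.
(* The row r(m-n, s) is the first unit row times an invertible matrix, so it cannot vanish. *)
have := mulmxK Tu (\row_(i < K) ((i : nat) == 0)%:R).
rewrite -[X in X *m _ = _]/(rec_row p q K X Xi 1 (m - n%:Z) s) row0 mul0mx.
have K0 : (0 < K)%N by rewrite lax_sizeE; lia.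
by move=> /rowP/(_ (Ordinal K0))/eqP; rewrite !mxE /= eq_sym oner_eq0.
Qed.

(** * The spectral polynomial, with zeta and xi as indeterminates *)

Local Notation pX := (polyC \o X).
Local Notation pXi := (polyC \o Xi).
Local Notation pM := (rec_step p q K pX pXi 'X).
Local Notation pT := (rec_transfer p q K pX pXi 'X).
Local Notation pBand :=
  (rec_band p q K pX pXi 'X (polyC \o laxW) beta%:P n s t).

Definition step_sign (m : int) : F := (-1) ^+ K.-1 * rec_lead p q Xi m.

(** This represents (L_m - xi) T(m-n, n); the inner indeterminate is zeta, the outer one xi. *)
Definition band_pencil (m : int) : 'M[{poly {poly F}}]_K :=
  map_mx polyC (pBand m) - 'X *: map_mx polyC (pT (m - n%:Z) n).

(* [laxL m = Band m * (transfer (m - n) n)^-1], and both factors are polynomial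
   in zeta. *)
Definition spectral_poly (m : int) : {poly {poly F}} :=
  ((\prod_(i < n) step_sign (m - n%:Z + i%:Z))^-1)%:P%:P * \det (band_pencil m).

Lemma step_sign_neq0 m : step_sign m != 0.
Proof. by rewrite mulf_neq0 ?signr_eq0 ?rec_lead_neq0. Qed.

Lemma spectral_poly_eval m (zeta xi : F) : zeta != 0 \/ n = 0%N ->
  (spectral_poly m).[xi%:P].[zeta]
    = zeta ^+ n * \det (laxL d1 d2 d3 tau beta m zeta - xi%:M).
Proof.
move=> adm; rewrite hornerM hornerC hornerM hornerC.
pose g : {rmorphism {poly {poly F}} -> F} := horner_eval zeta \o horner_eval xi%:P.
rewrite -[X in _ * X]/(g (\det (band_pencil m))) -det_map_mx.
have gC (k l : nat) (A : 'M[{poly F}]_(k, l)) :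
    map_mx g (map_mx polyC A) = map_mx (horner_eval zeta) A.
  by apply/matrixP => i j; rewrite !mxE /g /= /horner_eval hornerC.
have ev (h : int -> F) : horner_eval zeta \o (polyC \o h) =1 h.
  by move=> k; rewrite /= /horner_eval hornerC.
have evX : horner_eval zeta 'X = zeta by rewrite /horner_eval hornerX.
have evC (c : F) : horner_eval zeta c%:P = c by rewrite /horner_eval hornerC.
rewrite map_mxB map_mxZ !gC.
rewrite (map_rec_band _ _ _ (ev X) (ev Xi) evX _ _ _ _ (ev laxW) (evC beta)).
rewrite (map_rec_transfer _ _ _ (ev X) (ev Xi) evX).
have -> : g 'X = xi by rewrite /g /= /horner_eval hornerX hornerC.
(* Factoring out T(m-n, n) leaves its determinant: [zeta ^+ n] times the product that normalises
   [spectral_poly]. *)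
rewrite -laxL_band // -mul_scalar_mx -mulmxBl det_mulmx.
rewrite (det_rec_transfer _ _ _ lax_sizeE) // mulrCA mulKf 1?mulrC //.
by apply/prodf_neq0 => i _; exact: step_sign_neq0.
Qed.

(** The pencils at m and m+1 are intertwined by M_(m-n) and M_m. Their determinants thus differ by a
    ratio of step signs, which the normalisation absorbs. *)
Lemma spectral_poly_preserved :
    (forall m, Y (m + p%:Z) - beta * X m = laxW m) ->
  forall m, spectral_poly (m + 1) = spectral_poly m.
Proof.
move=> E m.
have band_lax : pBand (m + 1) *m pM (m - n%:Z) = pM m *m pBand m.
  have spt : (s + p = t + q)%N by lia.
  have pXV k : pXi k * pX k = 1 by rewrite /= -polyCM laxXV.
  apply: subr0_eq.
  rewrite (rec_band_lax _ lax_sizeE p_gt0 q_gt0 pq pXV spt); last first.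
    move=> k; have -> : k - n%:Z + t%:Z = k + b by lia.
    have -> : k - n%:Z + s%:Z = k + a by lia.
    by rewrite /= -!polyCM -polyCD -polyCB -polyCM laxW_compat polyCM.
  have D0 : rec_defect p pX (polyC \o laxW) beta%:P n t m = 0.
    have := rec_defectE m; rewrite E subrr /rec_defect /= => D0.
    by rewrite -!polyCM -polyCD -!polyCB D0.
  by apply/matrixP => i k; rewrite !mxE D0 mulr0 mul0r if_same.
have pencil_lax : band_pencil (m + 1) *m map_mx polyC (pM (m - n%:Z))
    = map_mx polyC (pM m) *m band_pencil m.
  rewrite mulmxBl mulmxBr -scalemxAl -scalemxAr.
  rewrite -!(map_mxM polyC) band_lax.
  have := rec_transfer_comm p q K pX pXi 'X (m - n%:Z) n.
  by rewrite addrAC subrK => ->.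
have det_pM k : \det (map_mx polyC (pM k)) = (step_sign k)%:P%:P * 'X%:P.
  rewrite det_map_mx (det_rec_step _ _ _ lax_sizeE) //.
  rewrite -[RHS]polyCM /step_sign /rec_lead; congr ((_ * _)%:P).
  by rewrite polyCM polyC_exp polyCN; case: ifP; rewrite //= polyCN.
have detE : \det (band_pencil (m + 1)) * ((step_sign (m - n%:Z))%:P%:P * 'X%:P)
    = (step_sign m)%:P%:P * 'X%:P * \det (band_pencil m).
  by rewrite -det_pM -det_mulmx pencil_lax det_mulmx det_pM.
(* Both sides are the product of the signs from m - n to m. *)
have prodE : \prod_(i < n) step_sign (m + 1 - n%:Z + i%:Z) * step_sign (m - n%:Z)
    = step_sign m * \prod_(i < n) step_sign (m - n%:Z + i%:Z).
  transitivity (\prod_(i < n.+1) step_sign (m - n%:Z + i%:Z)).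
    rewrite big_ord_recl /= addr0 mulrC; congr (_ * _).
    by apply: eq_bigr => i _; congr step_sign; rewrite /bump /=; lia.
  by rewrite big_ord_recr /= subrK mulrC.
have prod_neq0 k : \prod_(i < n) step_sign (k - n%:Z + i%:Z) != 0.
  by apply/prodf_neq0 => i _; exact: step_sign_neq0.
(* The indeterminate zeta is nonzero, so this determinant can be cancelled. *)
have XS : (step_sign (m - n%:Z))%:P%:P * ('X : {poly F})%:P != 0.
  by rewrite mulf_neq0 ?polyC_eq0 ?step_sign_neq0 ?polyX_eq0.
set C1 := \prod_(i < n) _ in prodE; set C0 := \prod_(i < n) _ in prodE.
have ratio : C1^-1 * step_sign m = C0^-1 * step_sign (m - n%:Z).
  apply: (mulfI (prod_neq0 (m + 1))); apply: (mulfI (prod_neq0 m)).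
  rewrite -/C0 -/C1 mulVKf ?prod_neq0 // mulrC -prodE.
  by rewrite [RHS]mulrCA mulVKf ?prod_neq0.
apply: (mulIf XS); rewrite /spectral_poly -/C0 -/C1 -mulrA detE.
transitivity ((C1^-1 * step_sign m)%:P%:P * ('X%:P * \det (band_pencil m))).
  by rewrite !polyCM !mulrA.
rewrite ratio !polyCM -!mulrA; congr (_ * _).
by rewrite [RHS]mulrC -!mulrA.
Qed.

(** * Compatibility, and equivalence with the scalar pair *)

Lemma compatibleP zeta :
  compatible d1 d2 d3 tau beta zeta <->
  forall m, discrete_lax_equation d1 d2 d3 tau beta m zeta.
Proof.
split=> [compat m | lax R iota xi m Phi PhiE].
  by apply: eigenvector_intertwining => R iota xi Phi; exact: compat.
by rewrite mulmxA -map_mxM lax map_mxM -mulmxA PhiE scalemxAr.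
Qed.

Section Wave.

Variables (R : comNzRingType) (iota : {rmorphism F -> R}) (zeta : F) (xi : R).
Hypothesis adm : zeta != 0 \/ n = 0%N.

(** The second scalar equation is the equation for M. Given it, entry i of L_m Phi_m is the
    left-hand side of the first scalar equation at m+i. *)
Lemma scalar_matrix_laxP (phi : int -> R) :
  scalar_lax_pair d1 d2 d3 tau beta iota zeta xi phi <->
  matrix_lax_pair tau beta iota zeta xi (@wave_vector d1 d2 d3 R phi).
Proof.
rewrite /scalar_lax_pair /matrix_lax_pair sh12 sh23 sh12' sh13'.
have XV m : (iota \o Xi) m * (iota \o X) m = 1.
  by rewrite /= -rmorphM laxXV rmorph1.
have mapM m : map_mx iota (laxM d1 d2 d3 tau m zeta)
    = rec_step p q K (iota \o X) (iota \o Xi) (iota zeta) m.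
  by rewrite laxM_rec; exact: map_rec_step.
have waveP := wave_recP (iota zeta) lax_sizeE p_gt0 q_gt0 pq XV phi.
have M_iff : (forall m, wave_vector d1 d2 d3 phi (m + 1)
      = map_mx iota (laxM d1 d2 d3 tau m zeta) *m wave_vector d1 d2 d3 phi m) <->
    (forall m, phi (m + p%:Z) - iota (X m) * phi (m + q%:Z) = iota zeta * phi m).
  by rewrite -waveP; split=> H m; have := H m; rewrite mapM.
suff L_iff : (forall m, phi (m + p%:Z) - iota (X m) * phi (m + q%:Z)
        = iota zeta * phi m) ->
    (forall m, iota (Y m) * phi (m + a) + iota (beta * zeta) * phi (m + (a - q%:Z))
        = xi * phi m) <->
    (forall m, map_mx iota (laxL d1 d2 d3 tau beta m zeta)
        *m wave_vector d1 d2 d3 phi m = xi *: wave_vector d1 d2 d3 phi m).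
  split=> [[H1 H2] | [H1 /M_iff H2]]; split=> //; last exact/L_iff.
    exact/L_iff.
  exact/M_iff.
move=> H.
have L_entry m i : (map_mx iota (laxL d1 d2 d3 tau beta m zeta)
      *m wave_vector d1 d2 d3 phi m) i ord0
    = iota (Y (m + i%:Z)) * phi (m + i%:Z + a)
      + iota (beta * zeta) * phi (m + i%:Z + (a - q%:Z)).
  (* Writing Phi_m as T(m-n, n) Phi_(m-n) replaces [laxL] by the band matrix. *)
  have Tw := transfer_wave lax_sizeE p_gt0 q_gt0 pq XV H (m - n%:Z) n.
  rewrite subrK in Tw; rewrite /wave_vector -{}Tw mulmxA.
  rewrite -(@map_rec_transfer _ _ iota p q K X Xi zeta) // -map_mxM laxL_band //.
  rewrite (@map_rec_band _ _ iota p q K X Xi zeta (iota \o X) (iota \o Xi)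
    (iota zeta) _ _ _ laxW (iota \o laxW) beta (iota beta)) //.
  have rw j := row_wave lax_sizeE p_gt0 q_gt0 pq XV H (m - n%:Z) j.
  transitivity (iota (laxW (m + i%:Z)) * phi (m + i%:Z + a)
      + iota beta * phi (m + i%:Z + b)).
    have -> : m + i%:Z + a = m - n%:Z + (i + s)%N%:Z by lia.
    have -> : m + i%:Z + b = m - n%:Z + (i + t)%N%:Z by lia.
    rewrite -!rw.
    rewrite mxE [X in _ = _ * X + _]mxE [X in _ = _ + _ * X]mxE.
    rewrite !mulr_sumr -big_split; apply: eq_bigr => j _.
    by rewrite mxE /= mulrDl !mulrA.
  (* The second scalar equation at m+i+d2+d3 brings phi_(m+i+d2+d3) back. *)
  have := H (m + i%:Z + (a - q%:Z)).
  have -> : m + i%:Z + (a - q%:Z) + p%:Z = m + i%:Z + b by lia.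
  have -> : m + i%:Z + (a - q%:Z) + q%:Z = m + i%:Z + a by lia.
  move/eqP; rewrite subr_eq => /eqP ->.
  by rewrite /laxW rmorphB !rmorphM; ring.
split=> [H1 m | H1 m].
  by apply/colP => i; rewrite L_entry H1 !mxE.
have K0 : (0 < K)%N by rewrite lax_sizeE; lia.
have /colP/(_ (Ordinal K0)) := H1 m; rewrite L_entry !mxE /= addr0; exact.
Qed.

End Wave.

End LaxPair.

(** * Passage from rational to integer shifts, and assembly *)

Theorem corollary2p2 (F : fieldType) (d1 d2 d3 : rat)
    (tau : int -> F) (beta : F)
    (hd : int_or_half_int d1 d2 d3)
    (hdistinct : uniq [:: d1; d2; d3])
    (hmax : Num.max d2 d3 < d1)
    (htau : forall m, tau m != 0) :
  (* the scalar pair is equivalent to the matrix system *)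
  (forall (R : comNzRingType) (iota : {rmorphism F -> R}) (zeta : F) (xi : R),
     admissible d1 d2 d3 zeta ->
     (forall phi : int -> R,
        scalar_lax_pair d1 d2 d3 tau beta iota zeta xi phi <->
        matrix_lax_pair tau beta iota zeta xi
          (@wave_vector d1 d2 d3 R phi)) /\
     (forall Phi : int -> 'cV[R]_(lax_size d1 d2 d3),
        matrix_lax_pair tau beta iota zeta xi Phi ->
        exists phi : int -> R, forall m, Phi m = wave_vector d1 d2 d3 phi m))
  /\
  (* the compatibility condition of the matrix system is the Lax equation *)
  (forall zeta : F, admissible d1 d2 d3 zeta ->
     (compatible d1 d2 d3 tau beta zeta <->
      forall m, discrete_lax_equation d1 d2 d3 tau beta m zeta))
  /\
  (* as for the scalar pair, this condition is the Somos recurrence *)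
  ((forall (zeta : F) (m : int), admissible d1 d2 d3 zeta ->
      discrete_lax_equation d1 d2 d3 tau beta m zeta) <->
   somos d1 d2 d3 tau beta)
  /\
  (* the Lax equation preserves the coefficients of the spectral polynomial *)
  (exists (k : nat) (P : int -> {poly {poly F}}),
     [/\ regular_shifts d1 d2 d3 -> k = 0%N,
         forall m, spectral_polynomial d1 d2 d3 tau beta k m (P m)
       & (forall (zeta : F) (m : int), admissible d1 d2 d3 zeta ->
            discrete_lax_equation d1 d2 d3 tau beta m zeta) ->
         forall m, P (m + 1) = P m]).
Proof.
have [a [p [q [[d12 d12' d13'] [p0 q0 pq]]]]] : exists a (p q : nat),
    [/\ d1 + d2 = a%:~R, d1 - d2 = p%:~R & d1 - d3 = q%:~R] /\
    [/\ (0 < p)%N, (0 < q)%N & p != q].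
  have [i12 i12' i13'] : [/\ d1 + d2 \is a Num.int, d1 - d2 \is a Num.int
      & d1 - d3 \is a Num.int].
    case: hd => -[i1 i2 i3]; first by rewrite rpredD ?rpredB.
    have half (e e' : rat) : e - e' = (e - 2^-1) - (e' - 2^-1) by ring.
    split; [|by rewrite (half d1 d2) rpredB|by rewrite (half d1 d3) rpredB].
    have -> : d1 + d2 = (d1 - 2^-1) + (d2 - 2^-1) + 1 by field.
    exact: (rpredD (rpredD i1 i2) (rpred1 _)).
  move: hmax hdistinct; rewrite gt_max /= !inE => /andP[lt2 lt3].
  rewrite negb_or => /andP[/andP[_ _]]; rewrite andbT => ne23.
  have pos (e : rat) : e \is a Num.int -> 0 < e ->
      exists2 k : nat, e = k%:~R & (0 < k)%N.
    move=> /intrP[[k|k] ->]; last by rewrite ltr0z.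
    by rewrite ltr0z => k0; exists k.
  have [p pE p0] := pos _ i12' (etrans (subr_gt0 _ _) lt2).
  have [q qE q0] := pos _ i13' (etrans (subr_gt0 _ _) lt3).
  have /intrP[a aE] := i12.
  exists a, p, q; split=> //; split=> //; apply: contra ne23 => /eqP pq.
  have : d1 - d2 = d1 - d3 by rewrite pE qE pq.
  by move/addrI/oppr_inj/eqP.
(* The least n making [a + n] and [a + p - q + n] nonnegative: each [absz (Num.min _ 0)] is a
   negative part. *)
pose n := maxn (absz (Num.min a 0)) (absz (Num.min (a + p%:Z - q%:Z) 0)).
have regE : regular_shifts d1 d2 d3 <-> n = 0%N.
  rewrite /regular_shifts d12 (d13 d12 d12' d13') !ler0z /n; lia.
have admE (zeta : F) : admissible d1 d2 d3 zeta <-> zeta != 0 \/ n = 0%N.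
  by rewrite /admissible regE.
have [s sE] : exists s : nat, s%:Z = a + n%:Z.
  by exists (absz (a + n%:Z)); lia.
have [t tE] : exists t : nat, t%:Z = a + p%:Z - q%:Z + n%:Z.
  by exists (absz (a + p%:Z - q%:Z + n%:Z)); lia.
have laxP : (forall (zeta : F) m, admissible d1 d2 d3 zeta ->
      discrete_lax_equation d1 d2 d3 tau beta m zeta) <->
    forall m, laxY d1 d2 d3 tau (m + p%:Z) - beta * laxX d1 d2 d3 tau m
      = laxW d1 d2 d3 tau beta a q m.
  rewrite -(lax_equationP beta d12 d12' d13' p0 q0 pq htau sE tE).
  by split=> H zeta m /admE; exact: H.
split; [|split; [|split]].
- move=> R iota zeta xi /admE adm; split.
    move=> phi.
    exact: (scalar_matrix_laxP beta d12 d12' d13' p0 q0 pq htau sE tE).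
  by move=> Phi; exact: (matrix_lax_wave d12' d13' p0 q0 pq).
- by move=> zeta _; exact: compatibleP.
- by rewrite laxP (somosP beta d12 d12' d13' p0 q0 pq htau).
exists n, (spectral_poly d1 d2 d3 tau beta a p q n s t); split.
- by move/regE.
- move=> m zeta xi /admE adm.
  exact: (spectral_poly_eval beta d12 d12' d13' p0 q0 pq htau sE tE).
move/laxP.
exact: (spectral_poly_preserved d12 d12' d13' p0 q0 pq htau sE tE).
Qed.
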